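(* For an integer $g>0$ and a prime $p$ not dividing $2(2g+1)$, let $K=\mathbb F_p(t)$ and let $C$ be the hyperelliptic curve over $K$ with affine equation $y^2=x^{2g+1}+t$. (1) If $p=3$ and $g=2$, then for all $q\in\mathrm{Jac}_C(K)$: $\ \hat{\mathrm h}(q)+86\log 3\ge \mathrm h^\heartsuit(q)=\mathrm h^\dagger(q)$. (2) If $p=5$ and $g=4$, then for all $q\in\mathrm{Jac}_C(K)$: $\ \hat{\mathrm h}(q)+417\log 5\ge \mathrm h^\heartsuit(q)=\mathrm h^\dagger(q)$. (3) If $p=101$ and $g=11$, then for all $q\in\mathrm{Jac}_C(K)$: $\ \hat{\mathrm h}(q)+5790\log 101\ge \mathrm h^\heartsuit(q)=\mathrm h^\dagger(q)$.
   Context: $C$ is viewed as the smooth projective curve $Y^2=SX^{2g+1}+tS^{2g+2}$ in $\mathbb P(1,1,g+1)$, with $x=X/S$, $y=Y/S^{g+1}$; $\infty$ is its Weierstrass point at $S=0$, and $q\mapsto q^-$ denotes the hyperelliptic involution $(X:S:Y)\mapsto(X:S:-Y)$. **Absolute values.** $M_K$ is the set of absolute values of $K=\mathbb F_p(t)$ satisfying the product formula and containing exactly once the $t$-adic absolute value normalised by $|t|_t=p^{-1}$ (so each place occurs once with its standard normalisation). For $L/K$ finite, $M_L$ is the multiset of absolute values of $L$ restricting to elements of $M_K$ for which the product formula holds (with multiplicity, the local degrees over each $\nu\in M_K$ add up to $[L:K]$). For $a\in L$, $\mathrm h(a)=\frac1{[L:K]}\sum_{\nu\in M_L}\log\max(|a|_\nu^{-1},1)$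 for $a\ne0$, $\mathrm h(0)=0$. The height of a nonzero polynomial over $L$ is $\frac1{[L:K]}\sum_{\nu\in M_L}\log\max_i|c_i|_\nu$, $c_i$ its coefficients. **The heights.** A divisor $D$ on $C$ is reduced if it is effective, $\deg D\le g$, and there is no prime divisor $P$ with $D\ge P+P^-$. Given $q\in\mathrm{Jac}_C(K)$, write $q=[D-\deg(D)\infty]$ with $D$ the unique reduced divisor whose coefficient at $\infty$ is $0$; then remove from $D$ all Weierstrass points in its support and call the result again $D$, of degree $d$. Over a finite extension write $D=\sum_{i=1}^dp_i$ and set $\mathrm h^\heartsuit(q)=\sum_{i=1}^d\mathrm h(x_{p_i})$ and $\mathrm h^\dagger(q)=\mathrm h\bigl(\prod_{i=1}^d(x-x_{p_i})\bigr)$ (height of a polynomial in $x$), where $x_{p_i}$ is the $x$-coordinate of $p_i$. $\hat{\mathrm h}$ is the Néron–Tate height on $\mathrm{Jac}_C(K)$ with respect to twice the theta divisor (theta being the image of $C^{g-1}$ under $(p_i)\mapsto[\sum p_i-(g-1)\infty]$), normalised using $M_K$. *)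

(* Defs.v *)
From HB Require Import structures.
From mathcomp Require Import all_boot all_order all_algebra all_field.
From mathcomp Require Import freeg.
From mathcomp Require Import boolp classical_sets cardinality fsbigop reals exp.

Set Implicit Arguments.
Unset Strict Implicit.
Unset Printing Implicit Defensive.

Import Order.TTheory GRing.Theory Num.Theory.

Local Open Scope classical_set_scope.
Local Open Scope ring_scope.

Notation ratfun p := {fraction {poly 'F_p}}.
Notation ratfun_t p := (tofrac ('X : {poly 'F_p})).

Section AbsoluteValues.
Variable R : realType.

Definition is_absval (F : fieldType) (w : F -> R) : Prop :=
  [/\ forall a, 0 <= w a,
      forall a, w a = 0 <-> a = 0,
      forall a b, w (a * b) = w a * w b
    & forall a b, w (a + b) <= w a + w b].

Section BaseField.
Variable p : nat.

Definition multp (P a : {poly 'F_p}) : nat :=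
  \max_(n < size a | dvdp (P ^+ n) a) n.

(* |a|_P = p ^ (- deg P * v_P(a)); in particular |t|_'X = p^-1. *)
Definition abs_fin (P : {poly 'F_p}) (a : ratfun p) : R :=
  if a == 0 then 0
  else p%:R ^ (- ((size P).-1%:Z *
         ((multp P \n_(repr a))%:Z - (multp P \d_(repr a))%:Z))).

Definition abs_inf (a : ratfun p) : R :=
  if a == 0 then 0
  else p%:R ^ ((size \n_(repr a))%:Z - (size \d_(repr a))%:Z).

Definition MK : set (ratfun p -> R) :=
  [set nu | nu = abs_inf \/
     exists P : {poly 'F_p},
       [/\ P \is monic, irreducible_poly P & nu = abs_fin P]].

Definition extends (L : fieldExtType (ratfun p)) (w : L -> R)
    (nu : ratfun p -> R) : Prop :=
  forall a : ratfun p, w (a%:A) = nu a.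

(* A multiset of absolute values of L is its multiplicity function.  The
   product formula fixes the multiplicities up to a common factor, and the last
   clause (they add up to [L : K] above each place) fixes that factor. *)
Definition is_ML (L : fieldExtType (ratfun p)) (M : (L -> R) -> nat) : Prop :=
  [/\ forall w, M w <> 0%N ->
        is_absval w /\ exists2 nu, MK nu & extends w nu,
      forall a : L, a != 0 ->
        finite_set [set w | M w <> 0%N /\ w a <> 1] /\
        \sum_(w \in [set: L -> R]) (M w)%:R * ln (w a) = 0
    & forall nu, MK nu ->
        (\sum_(w \in [set w : L -> R | extends w nu]) M w)%N = \dim {:L}].

Section Heights.
Variables (L : fieldExtType (ratfun p)) (M : (L -> R) -> nat).

Definition height (a : L) : R :=
  if a == 0 then 0
  else (\dim {:L})%:R^-1 *
       \sum_(w \in [set: L -> R]) (M w)%:R * ln (Num.max (w a)^-1 1).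

Definition height_poly (P : {poly L}) : R :=
  (\dim {:L})%:R^-1 *
  \sum_(w \in [set: L -> R])
     (M w)%:R * ln (\big[Num.max/0]_(i < size P) w P`_i).

Definition h_heart (xs : seq L) : R := \sum_(x <- xs) height x.

Definition h_dagger (xs : seq L) : R :=
  height_poly (\prod_(x <- xs) ('X - x%:P)).

End Heights.

Definition height_proj (n : nat) (v : 'rV[ratfun p]_n) : R :=
  \sum_(nu \in MK) ln (\big[Num.max/0]_(i < n) nu (v 0 i)).

End BaseField.
End AbsoluteValues.

(* The curve is handled through its geometric points, over an algebraic closure
   O of K = F_p(t); what is defined over K is singled out explicitly. *)
Section Curve.
Variables (p g : nat) (O : closedFieldType) (iota : {rmorphism ratfun p -> O}).

(* None is the point at infinity (1 : 0 : 0), Some (x, y) is (x : 1 : y). *)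
Definition pt : Type :=
  option {z : O * O | z.2 ^+ 2 == z.1 ^+ (2 * g + 1) + iota (ratfun_t p)}.
HB.instance Definition _ := Choice.on pt.

Definition infty : pt := None.

Definition cX (P : pt) : O := if P is Some z then (val z).1 else 1.
Definition cS (P : pt) : O := if P is Some _ then 1 else 0.
Definition cY (P : pt) : O := if P is Some z then (val z).2 else 0.

Lemma hinv_subproof
    (z : {z : O * O | z.2 ^+ 2 == z.1 ^+ (2 * g + 1) + iota (ratfun_t p)}) :
  ((val z).1, - (val z).2).2 ^+ 2 ==
  ((val z).1, - (val z).2).1 ^+ (2 * g + 1) + iota (ratfun_t p).
Proof. by rewrite /= sqrrN; exact: (valP z). Qed.

Definition hinv (P : pt) : pt :=
  if P is Some z then Some (exist _ ((val z).1, - (val z).2) (hinv_subproof z))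
  else None.

(* mform A d F: in the coordinates (X_i : S_i : Y_i) normalised as above, F is
   given on C^n by a polynomial with coefficients in A, homogeneous of degree
   d i in (X_i, S_i, Y_i) for the weights (1, 1, g + 1), for each i.  The values
   of F depend on the normalisation; F = 0 and ratios of two forms of the same
   multidegree do not. *)
Inductive mform (A : set O) (n : nat) :
    ('I_n -> nat) -> (('I_n -> pt) -> O) -> Prop :=
| mform_const c : A c -> mform A (fun _ => 0%N) (fun _ => c)
| mform_X i : mform A (fun k => nat_of_bool (k == i)) (fun P => cX (P i))
| mform_S i : mform A (fun k => nat_of_bool (k == i)) (fun P => cS (P i))
| mform_Y i :
    mform A (fun k => ((k == i) * g.+1)%N) (fun P => cY (P i))
| mform_add d F G :
    mform A d F -> mform A d G -> mform A d (fun P => F P + G P)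
| mform_mul d e F G : mform A d F -> mform A e G ->
    mform A (fun k => (d k + e k)%N) (fun P => F P * G P).

Definition form (A : set O) (d : nat) (u : pt -> O) : Prop :=
  mform A (fun _ : 'I_1 => d) (fun P => u (P ord0)).

(* Numerator and denominator of a uniformizer at Q: x - x(Q), or y when
   y(Q) = 0, or x^-(g+1) y at infinity. *)
Definition unif (Q : pt) : (pt -> O) * (pt -> O) :=
  match Q with
  | Some _ => if cY Q == 0 then (cY, fun P => cS P ^+ g.+1)
              else (fun P => cX P - cX Q * cS P, cS)
  | None => (cY, fun P => cX P ^+ g.+1)
  end.

(* ord_at Q u v k: for forms u, v of the same degree, u / v is a nonzero
   rational function of order k at Q, i.e.  u / v = T ^ (m - n) * (G / H)  with
   T = unif Q, k = m - n, and G / H a unit at Q. *)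
Definition ord_at (Q : pt) (u v : pt -> O) (k : int) : Prop :=
  [/\ exists P, u P != 0, exists P, v P != 0 &
   exists (d m n : nat) (G H : pt -> O),
     [/\ form setT d G /\ form setT d H, G Q != 0 /\ H Q != 0,
         k = m%:Z - n%:Z &
         forall P, u P * (unif Q).1 P ^+ n * (unif Q).2 P ^+ m * H P =
                   v P * (unif Q).1 P ^+ m * (unif Q).2 P ^+ n * G P]].

Definition ord_form (Q : pt) (d : nat) (u : pt -> O) (k : int) : Prop :=
  ord_at Q u (fun P => (if Q is Some _ then cS P else cX P) ^+ d) k.

Definition effective (D : {freeg pt}) : Prop := forall Q, 0 <= coeff Q D.

Definition lin_equiv (D E : {freeg pt}) : Prop :=
  exists (d : nat) (u v : pt -> O),
    [/\ form setT d u, form setT d v &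
        forall Q, ord_at Q u v (coeff Q D - coeff Q E)].

(* E is the scheme of common zeros on C of finitely many forms over K. *)
Definition effective_over_K (E : {freeg pt}) : Prop :=
  exists (d r : nat) (F : 'I_r -> pt -> O),
    [/\ forall i, form (range iota) d (F i),
        forall Q i, exists2 k, ord_form Q d (F i) k & coeff Q E <= k &
        forall Q, exists i, ord_form Q d (F i) (coeff Q E)].

(* K-divisors of degree 0.  As C has the K-point infty, Jac_C(K) is the group of
   these modulo lin_equiv. *)
Definition jac_div (q : {freeg pt}) : Prop :=
  deg q = 0 /\
  exists E1 E2, [/\ effective_over_K E1, effective_over_K E2 & q = E1 - E2].

Definition reduced_div (D : {freeg pt}) : Prop :=
  [/\ effective D, deg D <= g%:Z &
      ~ exists P, effective (D - (<< P >> + << hinv P >>))].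

Definition sum_pts (n : nat) (P : 'I_n -> pt) : {freeg pt} :=
  \sum_(i < n) << P i >>.

(* [sum_pts P - g * infty] lies on the theta divisor. *)
Definition in_theta (P : 'I_g -> pt) : Prop :=
  exists E : 'I_g.-1 -> pt, lin_equiv (sum_pts P) (sum_pts E + << infty >>).

Definition proj_eq (n : nat) (u v : 'rV[O]_n) : Prop :=
  exists2 c, c != 0 & u = c *: v.

Section TwoTheta.
Variables (N : nat) (phi : ('I_g -> pt) -> 'rV[O]_N.+1).

(* F gives phi, as a morphism over K to P^N, on the open set F != 0. *)
Definition local_rep (d : 'I_g -> nat) (F : ('I_g -> pt) -> 'rV[O]_N.+1) :
    Prop :=
  (forall j, mform (range iota) d (fun P => F P 0 j)) /\
  (forall P, F P != 0 -> proj_eq (phi P) (F P)).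

Definition subst_pt (P : 'I_g -> pt) (i : 'I_g) (Q : pt) : 'I_g -> pt :=
  fun k => if k == i then Q else P k.

(* The variety Jac_C is the quotient of C^g by linear equivalence: a morphism
   Jac_C -> P^N is a map on classes whose composite phi with
   (P_i) |-> [sum P_i - g infty] is a morphism C^g -> P^N.  The predicate says
   that phi comes from such a morphism over K, and that the pull-back to Jac_C of
   the hyperplane X_0 = 0 is twice the theta divisor.  As theta is irreducible,
   the multiplicity is read off along the curves
   Q |-> [Q + sum_(k != i) P_k - g infty], with the P_k affine of distinct
   x-coordinates, which meet theta transversally at Q = infty. *)
Definition two_theta_morphism : Prop :=
  [/\ forall P, phi P != 0 /\
        exists d F, local_rep d F /\ F P != 0,
      forall P P', lin_equiv (sum_pts P) (sum_pts P') ->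
        proj_eq (phi P) (phi P'),
      forall P, phi P 0 0 = 0 <-> in_theta P &
      forall (P : 'I_g -> pt) (i : 'I_g),
        P i = infty ->
        (forall k, k != i -> P k <> infty) ->
        (forall k l, k != i -> l != i -> k != l -> cX (P k) != cX (P l)) ->
        exists d F j, [/\ local_rep d F, F P 0 j != 0 &
          ord_at infty (fun Q => F (subst_pt P i Q) 0 0)
                       (fun Q => F (subst_pt P i Q) 0 j) 2]].

End TwoTheta.

(* The Neron-Tate height for twice theta: the quadratic form on Jac_C(K) at
   bounded distance from a Weil height for that divisor. *)
Definition is_neron_tate (R : realType) (hhat : {freeg pt} -> R) : Prop :=
  [/\ forall q q', jac_div q -> jac_div q' -> lin_equiv q q' ->
        hhat q = hhat q',
      forall q q', jac_div q -> jac_div q' ->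
        hhat (q + q') + hhat (q - q') = 2 * hhat q + 2 * hhat q' &
      exists (N : nat) (phi : ('I_g -> pt) -> 'rV[O]_N.+1) (c : R),
        two_theta_morphism phi /\
        forall q, jac_div q ->
          exists (P : 'I_g -> pt) (v : 'rV[ratfun p]_N.+1),
            [/\ lin_equiv q (sum_pts P - << infty >> *+ g),
                proj_eq (phi P) (map_mx iota v) &
                `|hhat q - height_proj R v| <= c]].

(* ps lists, with multiplicity, the points of D that are not Weierstrass. *)
Definition non_weierstrass_part (D : {freeg pt}) (ps : seq pt) : Prop :=
  forall Q, (count_mem Q ps)%:Z = if hinv Q == Q then 0 else coeff Q D.

(* zs lists the coordinates of the points ps in the finite extension L of K. *)
Definition coords_in (L : fieldExtType (ratfun p)) (j : {rmorphism L -> O})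
    (ps : seq pt) (zs : seq (L * L)) : Prop :=
  [seq (cX P, cY P) | P <- ps] = [seq (j z.1, j z.2) | z <- zs].

(* hhat q + B >= h_heart(q) = h_dagger(q) for all q in Jac_C(K). *)
Definition heart_bound (R : realType) (hhat : {freeg pt} -> R) (B : R) : Prop :=
  forall (q D : {freeg pt}) (ps : seq pt),
    jac_div q ->
    effective_over_K D -> reduced_div D -> coeff infty D = 0 ->
    lin_equiv q (D - << infty >> *~ deg D) ->
    non_weierstrass_part D ps ->
  forall (L : fieldExtType (ratfun p)) (j : {rmorphism L -> O})
    (M : (L -> R) -> nat) (zs : seq (L * L)),
    (forall a : ratfun p, j (a%:A) = iota a) ->
    is_ML M -> coords_in j ps zs ->
    let xs := [seq z.1 | z <- zs] in
    h_heart M xs <= hhat q + B /\ h_heart M xs = h_dagger M xs.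

End Curve.

(* Main.v *)
Require Import Defs.
From HB Require Import structures.
From mathcomp Require Import all_boot all_order all_algebra all_field.
From mathcomp Require Import freeg.
From mathcomp Require Import boolp classical_sets cardinality fsbigop reals exp.
From mathcomp Require Import ring lra zify.

(* Jac_C(K) is trivial: the affine coordinate ring
   K[x, y] / (y^2 - x^(2g+1) - t) is the localisation of the factorial ring
   F_p[x, y] at the nonzero polynomials in t = y^2 - x^(2g+1), hence a principal
   ideal domain.  So an effective K-divisor D with no point at infinity is the
   zero divisor of some h = a(x) + b(x) y.  If D is reduced, its degree is that
   of the norm a^2 - b^2 (x^(2g+1) + t), which is at least 2g + 1 > g unless
   b = 0; and b = 0 forces the zeros to be stable under the hyperelliptic
   involution, so that D = 0.  Thus q is principal, and all three heights
   vanish. *)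

Set Implicit Arguments.
Unset Strict Implicit.
Unset Printing Implicit Defensive.

Import Order.TTheory GRing.Theory Num.Theory.

Local Open Scope ring_scope.

(** * Factorisation in F[x, y] through evaluation at points of the plane *)

Lemma exists_minimizer (T : Type) (P : T -> Prop) (m : T -> nat) :
  (exists x, P x) -> exists2 x, P x & forall y, P y -> (m x <= m y)%N.
Proof.
move=> [x0 Px0].
have exP : exists n, `[< exists2 x, P x & m x = n >].
  by exists (m x0); apply/asboolP; exists x0.
case: (ex_minnP exP) => n /asboolP[x Px mx] minn; exists x => // y Py.
by rewrite mx; apply: minn; apply/asboolP; exists y.
Qed.

Section PlanePoint.
Variables (F : fieldType) (O : closedFieldType) (phi : {rmorphism F -> O}).
Implicit Types (x y : O) (s e : {poly F}) (b : {poly {poly F}}).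

Definition ev1 x : {poly F} -> O := horner_eval x \o map_poly phi.
HB.instance Definition _ x := GRing.RMorphism.on (ev1 x).

(** The inner variable of [{poly {poly F}}] stands for x, the outer one for y. *)
Definition ev2 x y : {poly {poly F}} -> O := horner_eval y \o map_poly (ev1 x).
HB.instance Definition _ x y := GRing.RMorphism.on (ev2 x y).

Lemma ev1X x : ev1 x 'X = x.
Proof. by rewrite /ev1 /= /horner_eval map_polyX hornerX. Qed.

Lemma ev1C x c : ev1 x c%:P = phi c.
Proof. by rewrite /ev1 /= /horner_eval map_polyC hornerC. Qed.

Lemma ev2X x y : ev2 x y 'X = y.
Proof. by rewrite /ev2 /= /horner_eval map_polyX hornerX. Qed.

Lemma ev2C x y s : ev2 x y s%:P = ev1 x s.
Proof. by rewrite /ev2 /= /horner_eval map_polyC hornerC. Qed.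

(** Euclidean division by a nonzero polynomial of least degree vanishing at [x]; [e] is 0 when [x]
    is transcendental. *)
Lemma ev1_kernel x : exists e, forall s, (ev1 x s == 0) = (e %| s).
Proof.
have [ex_s|no_s] := pselect (exists s, s != 0 /\ ev1 x s = 0); last first.
  exists 0 => s; rewrite dvd0p; apply/eqP/eqP => [xs0|->]; last exact: rmorph0.
  by apply: contrapT => /eqP s0; apply: no_s; exists s.
have [e [e0 xe] mine] :=
  @exists_minimizer _ _ (fun s : {poly F} => size s) ex_s.
exists e => s; apply/eqP/idP => [xs|/dvdpP[q ->]]; last first.
  by rewrite rmorphM /= xe mulr0.
apply/modp_eq0P/eqP; apply: contraT => r0.
have := ltn_modp s e; rewrite e0 ltnNge mine //; split=> //.
have /(congr1 (ev1 x)) := divp_eq s e.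
by rewrite rmorphD rmorphM /= xe mulr0 add0r xs.
Qed.

Lemma ev1_transcendental_or_algebraic x :
  (forall s, ev1 x s = 0 -> s = 0) \/ algebraicOver phi x.
Proof.
have [[s [s0 xs]]|no_s] := pselect (exists s, s != 0 /\ ev1 x s = 0).
  by right; exists s => //; apply/rootP.
left=> s xs; apply: contrapT => /eqP s0; apply: no_s; by exists s.
Qed.

Lemma dvd_coefs e b : (forall i, e %| b`_i) -> exists b', b = e *: b'.
Proof.
move=> eb; exists (\poly_(i < size b) (b`_i %/ e)).
apply/polyP=> i; rewrite coefZ coef_poly; case: ltnP => [_|ib].
  by rewrite mulrC divpK.
by rewrite mulr0 nth_default.
Qed.

Lemma map_ev1_eq0 x e b : (forall s, (ev1 x s == 0) = (e %| s)) ->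
  map_poly (ev1 x) b = 0 -> exists b', b = e *: b'.
Proof.
move=> xe xb; apply: dvd_coefs => i; rewrite -xe.
by rewrite -(coef_map (ev1 x)) xb coef0.
Qed.

(** This is Gauss's lemma. Over F(x) the kernel is generated by an element of least y-degree;
    choosing one whose leading coefficient has least degree in x makes it primitive, so that it also
    generates over F[x]. *)
Lemma ev2_kernel_transcendental x y : (forall s, ev1 x s = 0 -> s = 0) ->
  exists pi, forall b, ev2 x y b = 0 <-> exists q, b = q * pi.
Proof.
move=> xT.
have [ex_b|no_b] := pselect (exists b, b != 0 /\ ev2 x y b = 0); last first.
  exists 0 => b; split=> [xb|[q ->]]; last by rewrite mulr0 rmorph0.
  exists 0; rewrite mulr0; apply: contrapT => /eqP b0; apply: no_b.
  by exists b.
have [p1 [p10 xp1] min1] :=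
  @exists_minimizer _ _ (fun b : {poly {poly F}} => size b) ex_b.
have [pi [pi0 xpi szpi] minpi] := @exists_minimizer _
  (fun b => [/\ b != 0, ev2 x y b = 0 & size b = size p1])
  (fun b => size (lead_coef b)) (ex_intro _ p1 (And3 p10 xp1 erefl)).
exists pi => b; split=> [xb|[q ->]]; last by rewrite rmorphM /= xpi mulr0.
(* Pseudo-division: a nonzero remainder would be in the kernel with smaller y-degree than [pi]. *)
have ex_c : exists c, c != 0 /\ exists q, c *: b = q * pi.
  exists (lead_coef pi ^+ scalp b pi).
  split; first by rewrite expf_neq0 // lead_coef_eq0.
  exists (b %/ pi); rewrite Pdiv.Idomain.divp_eq.
  suff -> : b %% pi = 0 by rewrite addr0.
  apply/eqP; apply: contraT => r0.
  have := Pdiv.Idomain.ltn_modp b pi; rewrite pi0 ltnNge szpi min1 //.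
  split=> //; have /(congr1 (ev2 x y)) := Pdiv.Idomain.divp_eq b pi.
  by rewrite rmorphD rmorphM /= xpi mulr0 add0r -mul_polyC rmorphM /= xb mulr0.
have [c [c0 [q cb]] minc] :=
  @exists_minimizer _ _ (fun s : {poly F} => size s) ex_c.
(* A multiplier [c] of least degree is constant. Otherwise it has a root [z], and reduction at [z]
   lands in the domain O[y], so the minimal polynomial [e] of [z] divides [q] or [pi]. The first
   contradicts the choice of [c], the second that of [pi]. *)
have [sc1|/closed_rootP[z rz]] := eqVneq (size (map_poly phi c)) 1%N.
  move: sc1; rewrite size_map_poly => /eqP/size_poly1P[a a0 ca].
  exists ((a^-1)%:P *: q); rewrite -scalerAl -cb scalerA ca -polyCM.
  by rewrite mulVf // scale1r.
have [e ze] := ev1_kernel z.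
have : e %| c by rewrite -ze.
case/dvdpP=> c' cE.
have e0 : e != 0 by apply: contraNneq c0 => e0; rewrite cE e0 mulr0.
have c'0 : c' != 0 by apply: contraNneq c0 => c'0; rewrite cE c'0 mul0r.
have e1 : (1 < size e)%N.
  rewrite ltn_neqAle lt0n size_poly_eq0 e0 andbT eq_sym.
  apply/negP=> /size_poly1P[a a0 ea].
  have : ev1 z e == 0 by rewrite ze.
  by rewrite ea ev1C fmorph_eq0 (negPf a0).
have scale_ev2 u v : ev2 x y (u *: v) = ev1 x u * ev2 x y v.
  by rewrite -mul_polyC rmorphM /= ev2C.
have : map_poly (ev1 z) (q * pi) = 0.
  rewrite -cb -mul_polyC rmorphM /= map_polyC /=.
  by move/rootP: rz => rz; rewrite [X in X%:P]rz mul0r.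
rewrite rmorphM /= => /eqP; rewrite mulf_eq0 => /orP[] /eqP.
  case/(map_ev1_eq0 ze)=> q' qE.
  have : (size c <= size c')%N.
    apply: minc; split=> //; exists q'.
    have eP0 : e%:P != 0 by rewrite polyC_eq0.
    by apply: (mulfI eP0); rewrite !mul_polyC scalerA mulrC -cE cb qE scalerAl.
  rewrite cE size_mul //.
  case: (size e) e1 => // -[]// n _.
  by rewrite addnS /= leqNgt addnS ltnS leq_addr.
case/(map_ev1_eq0 ze)=> pi' piE.
have pi'0 : pi' != 0 by apply: contraNneq pi0 => h; rewrite piE h scaler0.
have : (size (lead_coef pi) <= size (lead_coef pi'))%N.
  apply: minpi; split=> //.
    have /eqP := xpi; rewrite piE scale_ev2 mulf_eq0 => /orP[/eqP/xT h|/eqP//].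
    by rewrite h eqxx in e0.
  by rewrite -szpi piE size_scale.
rewrite piE lead_coefZ size_mul ?lead_coef_eq0 //.
case: (size e) e1 => // -[]// n _.
by rewrite leqNgt addSn /= addSn ltnS leq_addl.
Qed.

(** Such a point is generic on the plane or on a curve in it, so its prime ideal has height at most
    one. When [x] is algebraic, the minimal polynomial of [x] is a generator: a polynomial not
    vanishing identically on the line above [x] would make [y] algebraic. *)
Lemma ev2_kernel x y : ~ (algebraicOver phi x /\ algebraicOver phi y) ->
  exists pi, forall b, ev2 x y b = 0 <-> exists q, b = q * pi.
Proof.
move=> xyT; have [/ev2_kernel_transcendental //|xA] :=
  ev1_transcendental_or_algebraic x.
have [e xe] := ev1_kernel x.
exists e%:P => b; split=> [xb|[q ->]]; last first.
  rewrite rmorphM /= ev2C; suff /eqP -> : ev1 x e == 0 by rewrite mulr0.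
  by rewrite xe.
suff /(map_ev1_eq0 xe)[q ->] : map_poly (ev1 x) b = 0.
  by exists q; rewrite mulrC mul_polyC.
apply: contrapT => /eqP b0; apply: xyT; split=> //.
apply/integral_algebraic/(integral_root b0); first exact/rootP.
move=> _ /(nthP 0)[i _ <-]; rewrite coef_map /=.
apply: integral_horner; last exact/integral_algebraic.
by move=> _ /(nthP 0)[k _ <-]; rewrite coef_map; apply: integral_id.
Qed.

(** As long as the [beta i] have a common zero in [S], the generator [pi] of its kernel divides all
    of them and is moved into [h]. The y-degree of [beta i0] plus the x-degree of its leading
    coefficient then drops, because [pi] is not constant. *)
Lemma common_factor (r : nat) (S : O -> O -> Prop)
    (beta : 'I_r -> {poly {poly F}}) :
  (forall x y, S x y -> ~ (algebraicOver phi x /\ algebraicOver phi y)) ->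
  (exists i, beta i != 0) ->
  exists h gamma, (forall i, beta i = h * gamma i) /\
    forall x y, S x y -> exists i, ev2 x y (gamma i) != 0.
Proof.
move=> ST [i0]; have [n] := ubnP (size (beta i0) + size (lead_coef (beta i0))).
elim: n beta => // n IHn beta bn bi0.
have [[x [y [Sxy bxy]]]|no_zero] := pselect
  (exists x y, S x y /\ forall i, ev2 x y (beta i) = 0); last first.
  exists 1, beta; split=> [i|x y Sxy]; first by rewrite mul1r.
  apply: contrapT => no_i; apply: no_zero; exists x, y; split=> // i.
  by apply: contrapT => /eqP bi; apply: no_i; exists i.
have [pi xpi] := @ev2_kernel x y (ST _ _ Sxy).
have /choice[beta' bE] i : exists q, beta i = q * pi by apply/xpi.
have pi0 : pi != 0 by apply: contraNneq bi0 => h; rewrite bE h mulr0.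
have b'0 : beta' i0 != 0 by apply: contraNneq bi0 => h; rewrite bE h mul0r.
have pi_size : (2 < size pi + size (lead_coef pi))%N.
  rewrite ltnNge; apply/negP=> pi2.
  have s1 : (0 < size pi)%N by rewrite lt0n size_poly_eq0.
  have s2 : (0 < size (lead_coef pi))%N.
    by rewrite lt0n size_poly_eq0 lead_coef_eq0.
  have /size_poly1P[c c0 piE] : size pi == 1%N.
    by rewrite eqn_leq s1 andbT -(leq_add2r 1) (leq_trans _ pi2) // leq_add2l.
  have /size_poly1P[a a0 cE] : size c == 1%N.
    rewrite piE lead_coefC size_polyC c0 /= add1n in pi2 s2.
    by rewrite eqn_leq s2 -ltnS pi2.
  have : ev2 x y pi = 0 by apply/xpi; exists 1; rewrite mul1r.
  by rewrite piE cE ev2C ev1C => /eqP; rewrite fmorph_eq0 (negPf a0).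
have [|//|h [gamma [b'E gE]]] := IHn beta'.
  have lb'0 : lead_coef (beta' i0) != 0 by rewrite lead_coef_eq0.
  move: bn; rewrite bE lead_coefM !size_mul ?lead_coef_eq0 //.
  move: b'0 lb'0 pi_size; rewrite -!size_poly_gt0.
  have arith (a l k m : nat) : (0 < a -> 0 < l -> 2 < k + m ->
    (a + k).-1 + (l + m).-1 < n.+1 -> a + l < n)%N by lia.
  exact: arith.
exists (h * pi), gamma; split=> // i.
by rewrite bE b'E mulrAC.
Qed.
End PlanePoint.

(** * The ring of functions a(x) + b(x) y on y^2 = f(x), and its norm *)

Section FunctionsOnTheCurve.
Variables (O : closedFieldType) (f : {poly O}).
Implicit Types (u v w : {poly O} * {poly O}) (x y : O).

(* The pair (a, b) stands for the function a(x) + b(x) y on y^2 = f(x). *)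
Definition evp u x y : O := u.1.[x] + u.2.[x] * y.
Definition mulp u v := (u.1 * v.1 + u.2 * v.2 * f, u.1 * v.2 + u.2 * v.1).
Definition norm u := u.1 ^+ 2 - u.2 ^+ 2 * f.

Lemma evp_mul u v x y :
  y ^+ 2 = f.[x] -> evp (mulp u v) x y = evp u x y * evp v x y.
Proof. by move=> yf; rewrite /evp /= !hornerE -yf; ring. Qed.

Lemma evp_norm u x y :
  y ^+ 2 = f.[x] -> (norm u).[x] = evp u x y * evp u x (- y).
Proof. by move=> yf; rewrite /evp /norm !hornerE -yf; ring. Qed.

Lemma norm_mul u v : norm (mulp u v) = norm u * norm v.
Proof. by rewrite /norm /=; ring. Qed.

Lemma closed_sqrt (c : O) : exists y, y ^+ 2 = c.
Proof.
have [y yc] := @solve_monicpoly O 2 (fun i => if i is 0%N then c else 0) isT.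
by exists y; rewrite yc !big_ord_recl big_ord0 /= expr0 mulr1 mul0r !addr0.
Qed.

(** If [s + 1] were not constant it would have a root, whereas all its values are 1. *)
Lemma poly_fun_eq0 (s : {poly O}) : (forall x, s.[x] = 0) -> s = 0.
Proof.
move=> s0; have [/eqP/size_poly1P[c _ sE]|/closed_rootP[x /rootP]] :=
  eqVneq (size (s + 1)) 1%N; last first.
  by rewrite !hornerE s0 add0r => /eqP; rewrite oner_eq0.
have {sE} sE : s = (c - 1)%:P by rewrite polyCB -sE addrK.
by move: (s0 0); rewrite sE hornerC => ->.
Qed.

Lemma evp_eq0_norm u :
  (forall x y, y ^+ 2 = f.[x] -> evp u x y = 0) -> norm u = 0.
Proof.
move=> u0; apply: poly_fun_eq0 => x; have [y yf] := closed_sqrt f.[x].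
by rewrite (evp_norm _ yf) u0 // mul0r.
Qed.

Hypotheses (f0 : f != 0) (f_odd : ~~ odd (size f)).

(** The degree of f is odd, so a^2 and b^2 f have degrees of different parity and their leading
    terms cannot cancel. *)
Lemma size_norm u :
  size (norm u) = maxn (size (u.1 ^+ 2)) (size (u.2 ^+ 2 * f)).
Proof.
rewrite /norm; have [a0|a0] := eqVneq u.1 0.
  by rewrite a0 expr0n /= sub0r size_polyN size_poly0 max0n.
have [b0|b0] := eqVneq u.2 0.
  by rewrite b0 expr0n /= mul0r subr0 size_poly0 maxn0.
have sizes : size (u.1 ^+ 2) != size (u.2 ^+ 2 * f).
  rewrite !expr2 !size_mul ?mulf_neq0 //; move: a0 b0 f0 f_odd.
  rewrite -!size_poly_gt0.
  case: (size u.1) (size u.2) (size f) => [//|a] [//|b] [//|k] _ _ _.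
  rewrite /= !addnS /= => kodd; apply: contraNneq kodd => /(congr1 odd).
  by rewrite /= !oddD !addbb /= => <-.
have [lt_ab|lt_ba] : (size (u.1 ^+ 2)%R < size (u.2 ^+ 2 * f)%R)%N \/
    (size (u.2 ^+ 2 * f)%R < size (u.1 ^+ 2)%R)%N.
  by apply/orP; rewrite -neq_ltn.
  rewrite (maxn_idPr (ltnW lt_ab)) addrC size_polyDl size_polyN //.
by rewrite (maxn_idPl (ltnW lt_ba)) size_polyDl // size_polyN.
Qed.

Lemma norm_eq0 u : norm u = 0 -> u = (0, 0).
Proof.
move/(congr1 (size : {poly O} -> nat)); rewrite size_norm size_poly0 => /eqP.
rewrite -leqn0 geq_max !leqn0 !size_poly_eq0 [_ * f == 0]mulf_eq0.
rewrite (negPf f0) orbF.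
rewrite !expf_eq0 /= => /andP[/eqP a0 /eqP b0].
by rewrite (surjective_pairing u) a0 b0.
Qed.

Lemma size_norm_ge u : u.2 != 0 -> (size f <= size (norm u))%N.
Proof.
move=> b0; rewrite size_norm leq_max; apply/orP; right.
rewrite size_mul ?expf_neq0 // -subn1 addnC -addnBA ?leq_addr //.
by rewrite size_poly_gt0 expf_neq0.
Qed.

(** The ring is a domain: the norm is multiplicative and vanishes only at 0. *)
Lemma evp_cancel u v w : u != (0, 0) ->
  (forall x y, y ^+ 2 = f.[x] ->
     evp u x y * evp v x y = evp u x y * evp w x y) ->
  forall x y, y ^+ 2 = f.[x] -> evp v x y = evp w x y.
Proof.
move=> u0 uvw.
have vw x y : evp (v.1 - w.1, v.2 - w.2) x y = evp v x y - evp w x y.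
  by rewrite /evp /= !hornerE; ring.
have : norm (mulp u (v.1 - w.1, v.2 - w.2)) = 0.
  apply: evp_eq0_norm => x y yf.
  by rewrite evp_mul // vw mulrBr uvw // subrr.
rewrite norm_mul => /eqP; rewrite mulf_eq0 => /orP[/eqP/norm_eq0/eqP|].
  by rewrite (negPf u0).
move=> /eqP/norm_eq0 vw0 x y _; apply/eqP; rewrite -subr_eq0 -vw vw0.
by rewrite /evp /= horner0 mul0r addr0.
Qed.

Lemma evp_cancelX u v w n : u != (0, 0) ->
  (forall x y, y ^+ 2 = f.[x] ->
     evp u x y ^+ n * evp v x y = evp u x y ^+ n * evp w x y) ->
  forall x y, y ^+ 2 = f.[x] -> evp v x y = evp w x y.
Proof.
move=> u0; elim: n => [|n IHn] uvw.
  by move=> x y yf; have := uvw x y yf; rewrite !expr0 !mul1r.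
apply: IHn => x y yf.
have [U UE] : exists U, forall x y, y ^+ 2 = f.[x] ->
    evp U x y = evp u x y ^+ n.
  elim: n {uvw} => [|n [U UE]].
    by exists (1, 0) => *; rewrite /evp /= hornerC horner0 mul0r addr0.
  by exists (mulp u U) => x' y' yf'; rewrite evp_mul // UE // exprS.
rewrite -UE // -!evp_mul //.
apply: (@evp_cancel u) yf => // x' y' yf'.
by rewrite !evp_mul // !UE // !mulrA -exprS uvw.
Qed.

Definition linp x1 : {poly O} * {poly O} := ('X - x1%:P, 0).

Lemma evp_linp x1 x y : evp (linp x1) x y = x - x1.
Proof. by rewrite /evp /= !hornerE. Qed.

Lemma linp_neq0 x1 : linp x1 != (0, 0).
Proof. by rewrite xpair_eqE polyXsubC_eq0. Qed.

Definition yp : {poly O} * {poly O} := (0, 1).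

Lemma evp_yp x y : evp yp x y = y.
Proof. by rewrite /evp /= !hornerE. Qed.

Lemma yp_neq0 : yp != (0, 0).
Proof. by rewrite xpair_eqE oner_eq0 andbF. Qed.

Section Order.
Variables (h v w s : {poly O} * {poly O}) (x1 y1 : O) (k : nat).
Hypotheses (xy1 : y1 ^+ 2 = f.[x1]) (s1 : evp s x1 y1 != 0).

(** The identity says that h has order at most k at (x1, y1), where x - x1 is the uniformizer. Since
    h does not vanish at the conjugate point, the norm cannot have a larger order at x1 than h has
    at (x1, y1). *)
Lemma norm_order :
  (forall x y, y ^+ 2 = f.[x] ->
     evp h x y * evp v x y * evp w x y = (x - x1) ^+ k * evp s x y) ->
  evp h x1 (- y1) != 0 -> ~~ (('X - x1%:P) ^+ k.+1 %| norm h).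
Proof.
move=> hE h1; apply/negP => /dvdpP[c nE].
(* Multiplying norm h = c (x - x1)^(k+1) by v w and cancelling h and (x - x1)^k leaves c (x - x1) v
   w on one side and s times the conjugate of h on the other. *)
suff : evp (mulp (linp x1) (mulp (c, 0) (mulp v w))) x1 y1 =
       evp (mulp s (h.1, - h.2)) x1 y1.
  rewrite !evp_mul // evp_linp subrr mul0r => /esym/eqP.
  rewrite mulf_eq0 (negPf s1) /= => /eqP h10.
  by move: h1; rewrite -h10 /evp /= !hornerE mulrN mulNr eqxx.
apply: (@evp_cancelX (linp x1) _ _ k) xy1; first exact: linp_neq0.
move=> x y yf; rewrite !evp_mul // !evp_linp.
have hN : evp (h.1, - h.2) x y = evp h x (- y).
  by rewrite /evp /= !hornerE mulrN mulNr.
have cE : evp (c, 0) x y = c.[x] by rewrite /evp /= !hornerE.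
rewrite hN cE [RHS]mulrA -hE //.
have := evp_norm h yf; rewrite nE !hornerE /= => nx.
transitivity (c.[x] * (x - x1) ^+ k.+1 * (evp v x y * evp w x y)).
  by rewrite exprS; ring.
by rewrite nx; ring.
Qed.

Hypotheses (y10 : y1 = 0) (f'1 : f^`().[x1] != 0).
Hypothesis hE : forall x y, y ^+ 2 = f.[x] ->
  evp h x y * evp v x y * evp w x y = y * evp s x y.

(** Here y is the uniformizer and y^2 = f1 (x - x1) with f1 a unit, so x - x1 has order 2. It cannot
    divide h, which has order at most 1 by [hE]. *)
Lemma weierstrass_not_dvd : ~ (root h.1 x1 /\ root h.2 x1).
Proof.
case=> /factor_theorem[a aE] /factor_theorem[b bE].
have /factor_theorem[f1 fE] : root f x1 by apply/rootP; rewrite -xy1 y10 expr0n.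
have f11 : f1.[x1] != 0.
  by move: f'1; rewrite fE derivM derivXsubC !hornerE subrr mulr0 add0r.
suff : evp (mulp yp (mulp (a, b) (mulp v w))) x1 y1 =
       evp (mulp (f1, 0) s) x1 y1.
  rewrite !evp_mul // evp_yp {1}y10 mul0r => /esym/eqP.
  by rewrite mulf_eq0 (negPf s1) orbF /evp /= !hornerE (negPf f11).
apply: (@evp_cancel yp) xy1; first exact: yp_neq0.
move=> x y yf; rewrite !evp_mul // !evp_yp.
have hx : evp h x y = (x - x1) * evp (a, b) x y.
  by rewrite /evp /= aE bE !hornerE; ring.
have fx : evp (f1, 0) x y = f1.[x] by rewrite /evp /= !hornerE.
have yy : y * y = f1.[x] * (x - x1) by rewrite -expr2 yf fE !hornerE.
transitivity (f1.[x] * (evp h x y * evp v x y * evp w x y)).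
  by rewrite hx mulrA yy; ring.
by rewrite hE // fx; ring.
Qed.

(** If h = a + b y vanishes at (x1, 0), then (x - x1)^2 divides a^2. Were it to divide the norm as
    well, it would divide b^2 f; as x1 is a simple root of f, x - x1 would divide both a and b. *)
Lemma weierstrass_norm_order :
  evp h x1 y1 = 0 -> ~~ (('X - x1%:P) ^+ 2 %| norm h).
Proof.
rewrite {1}/evp y10 mulr0 addr0 => /rootP rh1; apply/negP=> dvd2.
apply: weierstrass_not_dvd; split=> //.
have /factor_theorem[f1 fE] : root f x1 by apply/rootP; rewrite -xy1 y10 expr0n.
have f11 : f1.[x1] != 0.
  by move: f'1; rewrite fE derivM derivXsubC !hornerE subrr mulr0 add0r.
have : ('X - x1%:P) ^+ 2 %| h.2 ^+ 2 * f.
  rewrite -(@dvdp_subr _ _ (h.1 ^+ 2)) ?dvdp_exp2r //.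
  by rewrite dvdp_XsubCl.
rewrite fE mulrA expr2 dvdp_mul2r ?polyXsubC_eq0 // dvdp_XsubCl rootM.
by rewrite /root (negPf f11) orbF hornerE expf_eq0.
Qed.

End Order.
End FunctionsOnTheCurve.

(** * Auxiliary facts on fractions, multiplicities and degrees of divisors *)

Lemma fraction_num_den (R : idomainType) (a : {fraction R}) :
  exists n d : R, d != 0 /\ tofrac d * a = tofrac n.
Proof.
elim/quotW: a => x; exists \n_x, \d_x; split; first exact: denom_ratioP.
apply/eqP; rewrite !piE /= FracField.equivfE /FracField.mulf.
by rewrite !numden_Ratio ?oner_eq0 ?mul1r ?denom_ratioP // !mulr1 mulrC.
Qed.

Lemma dvd_count_roots (F : fieldType) (x : F) (rs : seq F) :
  ('X - x%:P) ^+ count_mem x rs %| \prod_(z <- rs) ('X - z%:P).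
Proof.
elim: rs => [|z rs IHrs]; first by rewrite big_nil /= expr0 dvd1p.
rewrite big_cons /= exprD; apply: dvdp_mul => //.
by case: eqVneq => [->|_]; rewrite ?expr1 ?expr0 ?dvd1p ?dvdpp.
Qed.

Lemma sum_coeff_le_deg (K : choiceType) (D : {freeg K}) (s : seq K) :
  (forall z, 0 <= coeff z D) -> uniq s ->
  \sum_(z <- s) coeff z D <= deg D.
Proof.
move=> D0 us; rewrite -[in deg D](freeg_sumE D) raddf_sum /=.
under [leRHS]eq_bigr do rewrite degU.
rewrite (bigID (mem (dom D))) /= [X in _ + X]big1 ?addr0; last first.
  by move=> z; exact: coeff_outdom.
rewrite [leRHS](bigID (mem s)) /= -big_filter -[in leRHS]big_filter.
rewrite (perm_big [seq z <- dom D | z \in s]) /=.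
  by rewrite lerDl; apply: sumr_ge0 => z _; exact: D0.
apply: uniq_perm; rewrite ?filter_uniq ?uniq_dom // => z.
by rewrite !mem_filter andbC.
Qed.

(** * Forms over K as polynomials over F_p in the affine coordinates *)

Section Curve.
Variables (p g : nat) (O : closedFieldType) (iota : {rmorphism ratfun p -> O}).
Local Notation pt := (pt g iota).
Local Notation infty := (infty g iota).

(** The scalars are those of F_p and not of K, so that t becomes a polynomial in the coordinates. *)
Definition Fp_emb : 'F_p -> O := iota \o @tofrac {poly 'F_p} \o polyC.
HB.instance Definition _ := GRing.RMorphism.on Fp_emb.

Definition tval : O := iota (ratfun_t p).
Definition rhs : {poly O} := 'X^(2 * g + 1) + tval%:P.

Lemma tval_neq0 : tval != 0.
Proof. by rewrite fmorph_eq0 tofrac_eq0 polyX_eq0. Qed.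

Lemma horner_rhs x : rhs.[x] = x ^+ (2 * g + 1) + tval.
Proof. by rewrite /rhs !hornerE. Qed.

Lemma size_rhs : size rhs = (2 * g).+2.
Proof. by rewrite size_XnaddC addn1. Qed.

Lemma rhs_neq0 : rhs != 0.
Proof. by rewrite -size_poly_gt0 size_rhs. Qed.

Lemma rhs_odd : ~~ odd (size rhs).
Proof. by rewrite size_rhs /= negbK mul2n odd_double. Qed.

(** The derivative is (2g + 1) x^(2g), and 0 is not a root because t is not 0. *)
Lemma rhs_separable x : prime p -> ~~ (p %| 2 * g + 1)%N ->
  root rhs x -> rhs^`().[x] != 0.
Proof.
move=> p_pr pg /rootP; rewrite horner_rhs => fx.
have x0 : x != 0.
  apply: contra_eq_neq fx => ->.
  by rewrite addn1 expr0n /= add0r tval_neq0.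
rewrite derivD derivXn derivC addr0 hornerMn hornerXn -mulr_natr.
have cg : ((2 * g + 1)%:R : O) != 0.
  rewrite -(rmorph_nat Fp_emb) fmorph_eq0.
  by rewrite -(dvdn_pcharf (pchar_Fp p_pr)).
by rewrite mulf_neq0 // expf_neq0.
Qed.

Lemma affine_on_curve (Q : pt) : Q <> infty -> cY Q ^+ 2 = rhs.[cX Q].
Proof.
by case: Q => [[z zE]|//] _; rewrite horner_rhs (eqP zE).
Qed.

Lemma point_of (x y : O) : y ^+ 2 = rhs.[x] ->
  exists Q : pt, [/\ Q <> infty, cX Q = x & cY Q = y].
Proof.
rewrite horner_rhs => /eqP xy.
by exists (Some (exist _ (x, y) xy)).
Qed.

Lemma ev1_tval (s : {poly 'F_p}) : ev1 Fp_emb tval s = iota (tofrac s).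
Proof.
elim/poly_ind: s => [|s c IHs]; first by rewrite !rmorph0.
by rewrite !rmorphD !rmorphM /= IHs ev1X ev1C.
Qed.

(** Substitute y^2 - x^(2g+1) for t. *)
Lemma lift_t (s : {poly 'F_p}) : exists b : {poly {poly 'F_p}},
  forall x y, y ^+ 2 = rhs.[x] -> ev2 Fp_emb x y b = iota (tofrac s).
Proof.
elim/poly_ind: s => [|s c [b bE]]; first by exists 0 => x y _; rewrite !rmorph0.
exists (b * ('X ^+ 2 - ('X ^+ (2 * g + 1))%:P) + c%:P%:P) => x y xy.
rewrite -ev1_tval !rmorphD !rmorphM /= ev1X ev1C !ev2C ev1_tval -(bE _ _ xy).
rewrite rmorphB /= rmorphXn /= ev2X !ev2C ev1C.
congr (_ * _ + _); rewrite xy rmorphXn /= ev1X horner_rhs.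
by rewrite addrAC subrr add0r.
Qed.

(** Otherwise t = y^2 - x^(2g+1) would be algebraic over F_p. This makes [common_factor] applicable
    to all affine points of the curve. *)
Lemma curve_transcendental x y : y ^+ 2 = rhs.[x] ->
  ~ (algebraicOver Fp_emb x /\ algebraicOver Fp_emb y).
Proof.
move=> xy [/integral_algebraic xA /integral_algebraic yA].
have X n (z : O) : integralOver Fp_emb z -> integralOver Fp_emb (z ^+ n).
  move=> zA; elim: n => [|n IHn]; first by rewrite expr0; apply: integral1.
  by rewrite exprS; apply: integral_mul.
have : integralOver Fp_emb tval.
  have -> : tval = y ^+ 2 - x ^+ (2 * g + 1) by rewrite xy horner_rhs; ring.
  by apply: integral_sub; apply: X.
case/integral_algebraic=> s s0 /rootP st.
by have := ev1_tval s; rewrite /ev1 /= /horner_eval st => /esym/eqP;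
  rewrite fmorph_eq0 tofrac_eq0 (negPf s0).
Qed.

(** At an affine point S = 1, and products are reduced by y^2 = [rhs]. *)
Lemma mform_evp A (d : 'I_1 -> nat) (F : ('I_1 -> pt) -> O) : mform A d F ->
  exists U, forall P, P ord0 <> infty ->
    F P = evp U (cX (P ord0)) (cY (P ord0)).
Proof.
elim=> {d F} [c _|i|i|i|d F G _ [U UE] _ [V VE]|d e F G _ [U UE] _ [V VE]].
- by exists (c%:P, 0) => P _; rewrite /evp /= !hornerE.
- by exists ('X, 0) => P _; rewrite (ord1 i) /evp /= !hornerE.
- exists (1, 0) => P; rewrite (ord1 i) /evp /= !hornerE.
  by case: (P ord0).
- by exists (0, 1) => P _; rewrite (ord1 i) /evp /= !hornerE.
- exists (U.1 + V.1, U.2 + V.2) => P Pi; rewrite UE // VE //.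
  by rewrite /evp /= !hornerD mulrDl addrACA.
- exists (mulp rhs U V) => P Pi; rewrite UE // VE //.
  by rewrite evp_mul //; apply: affine_on_curve.
Qed.

Lemma form_evp A d (u : pt -> O) : Defs.form A d u ->
  exists U, forall Q, Q <> infty -> u Q = evp U (cX Q) (cY Q).
Proof.
by case/mform_evp=> U UE; exists U => Q Qi; exact: (UE (fun _ => Q)).
Qed.

(** The factor [c] clears the denominators of the coefficients, after which [lift_t] eliminates
    t. *)
Lemma mform_ev2 (d : 'I_1 -> nat) (F : ('I_1 -> pt) -> O) :
  mform (range iota) d F ->
  exists (b : {poly {poly 'F_p}}) (c : {poly 'F_p}), c != 0 /\
    forall P, P ord0 <> infty ->
      iota (tofrac c) * F P = ev2 Fp_emb (cX (P ord0)) (cY (P ord0)) b.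
Proof.
elim=> {d F} [_ [a _ <-]|i|i|i|d F G _ [b [c [c0 bE]]] _ [b' [c' [c'0 b'E]]]
   |d e F G _ [b [c [c0 bE]]] _ [b' [c' [c'0 b'E]]]].
- have [n [c [c0 cE]]] := fraction_num_den a; have [b bE] := lift_t n.
  exists b, c; split=> // P Pi.
  by rewrite -rmorphM /= cE bE //; apply: affine_on_curve.
- exists 'X%:P, 1; split=> [|P _]; first exact: oner_neq0.
  by rewrite !rmorph1 mul1r ev2C ev1X (ord1 i).
- exists 1, 1; split=> [|P]; first exact: oner_neq0.
  by rewrite !rmorph1 mul1r (ord1 i); case: (P ord0).
- exists 'X, 1; split=> [|P _]; first exact: oner_neq0.
  by rewrite !rmorph1 mul1r ev2X (ord1 i).
- have [k kE] := lift_t c; have [k' k'E] := lift_t c'.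
  exists (k' * b + k * b'), (c * c'); split=> [|P Pi]; first exact: mulf_neq0.
  have PC := affine_on_curve Pi.
  by rewrite rmorphD !rmorphM /= -bE // -b'E // kE // k'E //; ring.
- exists (b * b'), (c * c'); split=> [|P Pi]; first exact: mulf_neq0.
  by rewrite !rmorphM /= -bE // -b'E //; ring.
Qed.

Lemma ev2_evp (b : {poly {poly 'F_p}}) :
  exists U, forall x y, y ^+ 2 = rhs.[x] -> ev2 Fp_emb x y b = evp U x y.
Proof.
elim/poly_ind: b => [|b c [U UE]].
  by exists (0, 0) => x y _; rewrite rmorph0 /evp /= !hornerE.
exists (U.2 * rhs + map_poly Fp_emb c, U.1) => x y xy.
rewrite rmorphD rmorphM /= UE // ev2X ev2C /evp /= hornerD hornerM -xy.
by rewrite /ev1 /= /horner_eval; ring.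
Qed.

Definition unifp (Q : pt) :=
  if cY Q == 0 then @yp O else linp (cX Q).

Lemma unifp_neq0 Q : unifp Q != (0, 0).
Proof. by rewrite /unifp; case: ifP => _; [exact: yp_neq0|exact: linp_neq0].
Qed.

Lemma evp_unifp Q : evp (unifp Q) (cX Q) (cY Q) = 0.
Proof.
by rewrite /unifp; case: eqP => [y0|_]; rewrite ?evp_yp // evp_linp subrr.
Qed.

Lemma unif_affine (Q P : pt) : Q <> infty -> P <> infty ->
  (unif Q).1 P = evp (unifp Q) (cX P) (cY P) /\ (unif Q).2 P = 1.
Proof.
case: Q => [Q|//] _; case: P => [P|//] _; rewrite /unif /unifp.
case: ifP => _; rewrite ?evp_yp ?evp_linp /= ?expr1n //.
by rewrite mulr1.
Qed.

(** On affine points the denominators in [ord_form] and [unif] are 1; with m = n + k, the n-th power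
    of the uniformizer cancels. *)
Lemma ord_form_affine (Q : pt) (d k : nat) (u : pt -> O) U : Q <> infty ->
  (forall P, P <> infty -> u P = evp U (cX P) (cY P)) ->
  ord_form Q d u k%:Z ->
  exists G H, [/\ evp G (cX Q) (cY Q) != 0, evp H (cX Q) (cY Q) != 0 &
    forall x y, y ^+ 2 = rhs.[x] ->
      evp U x y * evp H x y = evp (unifp Q) x y ^+ k * evp G x y].
Proof.
move=> Qi uE [_ _ [e [m [n [G [H [[/form_evp[G' GE] /form_evp[H' HE]]]]]]]]].
case=> GQ HQ kE uG; exists G', H'; split; rewrite -?GE -?HE //.
have mE : (m = n + k)%N by lia.
(* The [iter] is a pair representing the k-th power of the uniformizer, which brings both sides into
   the form that [evp_cancelX] handles. *)
suff cancel x y : y ^+ 2 = rhs.[x] -> evp (mulp rhs U H') x y =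
    evp (mulp rhs G' (iter k (mulp rhs (unifp Q)) (1, 0))) x y.
  move=> x y xy; move: (cancel x y xy); rewrite !evp_mul // => ->.
  rewrite mulrC; congr (_ * _); elim: (k) => [|j IHj] /=.
    by rewrite /evp /= !hornerE.
  by rewrite evp_mul // IHj exprS.
move: x y; apply: (@evp_cancelX _ _ rhs_neq0 rhs_odd (unifp Q) _ _ n).
  exact: unifp_neq0.
move=> x y xy; rewrite !evp_mul //.
have -> : evp (iter k (mulp rhs (unifp Q)) (1, 0)) x y = evp (unifp Q) x y ^+ k.
  elim: (k) => [|j IHj] /=; first by rewrite /evp /= !hornerE.
  by rewrite evp_mul // IHj exprS.
have [P [Pi Px Py]] := point_of xy.
have [T1 T2] := unif_affine Qi Pi.
have cS1 : cS P = 1 by case: (P) Pi.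
have vE : (if Q is Some _ then cS P else cX P) ^+ d = 1.
  by case: (Q) Qi => // ? _; rewrite cS1 expr1n.
have := uG P; rewrite vE T1 T2 !expr1n !mulr1 mul1r uE // GE // HE // Px Py.
by rewrite mE exprD => uG'; rewrite mulrCA mulrA uG'; ring.
Qed.

End Curve.

(** * Reduced divisors over K without point at infinity vanish *)

Lemma size_sum_count (T : eqType) (s : seq T) :
  size s = (\sum_(x <- undup s) count_mem x s)%N.
Proof.
rewrite -{1}(perm_size (perm_count_undup s)) size_flatten /shape -map_comp.
by rewrite sumnE big_map; apply: eq_bigr => x _; rewrite /= size_nseq.
Qed.

Section TrivialJacobian.
Variables (p g : nat) (O : closedFieldType) (iota : {rmorphism ratfun p -> O}).
Local Notation pt := (pt g iota).
Local Notation infty := (infty g iota).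
Local Notation rhs := (rhs g iota).
Local Notation Fp_emb := (Fp_emb iota).
Implicit Types (Q : pt) (D : {freeg pt}).

Lemma hinvE Q : Q <> infty ->
  [/\ hinv Q <> infty, cX (hinv Q) = cX Q & cY (hinv Q) = - cY Q].
Proof. by case: Q. Qed.

Lemma pt_inj Q Q' : Q <> infty -> Q' <> infty ->
  cX Q = cX Q' -> cY Q = cY Q' -> Q = Q'.
Proof.
case: Q => [[[x y] /= e]|//] _; case: Q' => [[[x' y'] /= e']|//] _ /= xx yy.
by congr Some; apply: val_inj; rewrite /= xx yy.
Qed.

(** As 2 is invertible, the affine fixed points of the involution are those with y = 0. In either
    case a failure would give D >= Q + Q^-. *)
Lemma coeff_hinv D Q : (2 : O) != 0 -> Q <> infty -> reduced_div D ->
  0 < coeff Q D -> if cY Q == 0 then coeff Q D = 1 else coeff (hinv Q) D = 0.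
Proof.
move=> two Qi [D0 _ Dred] DQ.
have Qh : (Q == hinv Q) = (cY Q == 0).
  have [hi hX hY] := hinvE Qi.
  apply/eqP/eqP => [/(congr1 (@cY _ _ _ _))|y0]; last first.
    by apply: pt_inj; rewrite // hY y0 oppr0.
  rewrite hY => /eqP; rewrite -addr_eq0 -mulr2n -mulr_natl mulf_eq0.
  by rewrite (negPf two) => /eqP.
have [y0|y0] := ifP; apply: contrapT => DQ'; apply: Dred; exists Q => z.
  have := D0 z; rewrite coeffB coeffD !coeffU !mul1r.
  move: Qh; rewrite y0 => /eqP <-.
  by have [<-|_] := eqVneq Q z; [move: DQ DQ' | ]; lia.
have := D0 z; have := D0 (hinv Q); rewrite coeffB coeffD !coeffU !mul1r.
have [<-|_] := eqVneq Q z; first by rewrite eq_sym Qh y0; move: DQ; lia.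
by have [<-|_] := eqVneq (hinv Q) z; move: DQ'; lia.
Qed.

Lemma unit_at_neq0 Q k G : Q <> infty -> evp G (cX Q) (cY Q) != 0 ->
  ~ (forall x y, y ^+ 2 = rhs.[x] ->
       evp (unifp Q) x y ^+ k * evp G x y = 0).
Proof.
move=> Qi GQ TG0; move: GQ; apply/negP; rewrite negbK; apply/eqP.
have zeroE x y : evp (0, 0) x y = 0 :> O by rewrite /evp /= !hornerE.
rewrite -(zeroE (cX Q) (cY Q)).
have := affine_on_curve Qi; apply: (@evp_cancelX _ _ _ _ (unifp Q) _ _ k).
- exact: rhs_neq0.
- exact: rhs_odd.
- exact: unifp_neq0.
- by move=> x y xy; rewrite zeroE mulr0 TG0.
Qed.

(* h is the greatest common divisor, in F_p[x, y], of the forms that define D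
   after their denominators in F_p[t] are cleared. *)
Lemma effective_over_K_principal D : effective D -> effective_over_K D ->
  (exists2 Q, Q <> infty & coeff Q D != 0) ->
  exists h : {poly O} * {poly O},
    (forall Q, Q <> infty -> (evp h (cX Q) (cY Q) == 0) = (0 < coeff Q D)) /\
    forall Q (k : nat), Q <> infty -> coeff Q D = k%:Z ->
      exists v w G, evp G (cX Q) (cY Q) != 0 /\
        forall x y, y ^+ 2 = rhs.[x] ->
          evp h x y * evp v x y * evp w x y =
          evp (unifp Q) x y ^+ k * evp G x y.
Proof.
move=> D0 [d [r [F [FK Fge Fex]]]] [Q0 Q0i DQ0].
have Fevp i := form_evp (FK i).
have /choice[b /choice[c bE]] i :
    exists (b : {poly {poly 'F_p}}) (c : {poly 'F_p}), c != 0 /\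
    forall Q, Q <> infty -> iota (tofrac c) * F i Q = ev2 Fp_emb (cX Q) (cY Q) b.
  have [b [c [c0 bE]]] := mform_ev2 (FK i); exists b, c; split=> // Q Qi.
  exact: (bE (fun _ => Q)).
have c0 i : iota (tofrac (c i)) != 0.
  by rewrite fmorph_eq0 tofrac_eq0; case: (bE i).
have FE i Q : Q <> infty ->
    iota (tofrac (c i)) * F i Q = ev2 Fp_emb (cX Q) (cY Q) (b i).
  by case: (bE i) => _; apply.
have F0 i Q : Q <> infty ->
    (ev2 Fp_emb (cX Q) (cY Q) (b i) == 0) = (F i Q == 0).
  by move=> Qi; rewrite -FE // mulf_eq0 (negPf (c0 i)).
have Dnat Q : exists k : nat, coeff Q D = k%:Z.
  by have := D0 Q; case: (coeff Q D) => // k _; exists k.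
(* A form whose order at [Q0] is the coefficient of D is not identically zero. *)
have [i0 bi0] : exists i, b i != 0.
  have [i Fi] := Fex Q0; exists i; apply/eqP => bi.
  have [k kE] := Dnat Q0; rewrite kE in Fi.
  have [U UE] := Fevp i.
  have [G [H [GQ _ UG]]] := ord_form_affine Q0i UE Fi.
  apply: (unit_at_neq0 (k := k) Q0i GQ) => x y xy; rewrite -UG //.
  have [P [Pi <- <-]] := point_of xy; rewrite -UE //.
  have := F0 i P Pi; rewrite bi rmorph0 eqxx => /esym/eqP ->.
  by rewrite mul0r.
have [h [gamma [bh gh]]] := common_factor (@curve_transcendental p g O iota)
  (ex_intro _ i0 bi0).
have [hh hhE] := ev2_evp g iota h.
exists hh; split=> [Q Qi|Q k Qi DQ].
  have PC := affine_on_curve Qi; rewrite -hhE //.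
  apply/eqP/idP => [hQ|DQ].
    rewrite lt_neqAle D0 andbT eq_sym; apply/eqP => DQ.
    have [i Fi] := Fex Q; rewrite DQ in Fi.
    have [U UE] := Fevp i.
    have [G [H [GQ _ UG]]] := ord_form_affine (k := 0) Qi UE Fi.
    have := UG _ _ PC; rewrite expr0 mul1r -UE //.
    have /esym := F0 i Q Qi; rewrite bh rmorphM /= hQ mul0r eqxx => /eqP ->.
    by rewrite mul0r => /esym/eqP; rewrite (negPf GQ).
  have [i gi] := gh _ _ PC; apply/eqP.
  suff : ev2 Fp_emb (cX Q) (cY Q) (b i) == 0.
    by rewrite bh rmorphM /= mulf_eq0 (negPf gi) orbF.
  rewrite F0 //.
  have [m Fi Dm] := Fge Q i.
  have [n mE] : exists n : nat, m = n.+1%:Z.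
    by case: m {Fi} Dm => [[|n]|n] Dm; [lia|exists n|lia].
  rewrite mE in Fi; have [U UE] := Fevp i.
  have [G [H [_ HQ UG]]] := ord_form_affine Qi UE Fi.
  have := UG _ _ PC; rewrite evp_unifp expr0n mul0r -UE // => /eqP.
  by rewrite mulf_eq0 (negPf HQ) orbF.
have [i Fi] := Fex Q; rewrite DQ in Fi.
have [U UE] := Fevp i.
have [G [H [GQ HQ UG]]] := ord_form_affine Qi UE Fi.
(* The form [F i] has order exactly k at Q and equals h times [gamma i] up to the unit [a], so
   [gamma i] and [H] serve as cofactors of h. *)
have [v vE] := ev2_evp g iota (gamma i).
pose a := iota (tofrac (c i)).
have aE x y : evp (a *: G.1, a *: G.2) x y = a * evp G x y.
  by rewrite /evp /= !hornerZ mulrDr mulrA.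
exists v, H, (a *: G.1, a *: G.2); split=> [|x y xy].
  by rewrite aE; apply: mulf_neq0 (c0 i) GQ.
have bE' : ev2 Fp_emb x y (b i) = ev2 Fp_emb x y h * ev2 Fp_emb x y (gamma i).
  by rewrite bh rmorphM.
rewrite -hhE // -vE // -bE' aE mulrCA -UG // mulrA.
by have [P [Pi <- <-]] := point_of xy; rewrite -FE // -UE.
Qed.

Hypotheses (p_prime : prime p) (p_ndvd : ~~ (p %| 2 * (2 * g + 1))%N).

Lemma reduced_over_K_eq0 D :
  effective_over_K D -> reduced_div D -> coeff infty D = 0 -> D = 0.
Proof.
move=> DK Dr Dinf; have [D0 Dg _] := Dr.
have two : (2 : O) != 0.
  rewrite -(rmorph_nat Fp_emb) fmorph_eq0 -(dvdn_pcharf (pchar_Fp p_prime)).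
  by apply: contra p_ndvd; apply: dvdn_mulr.
have pg : ~~ (p %| 2 * g + 1)%N by apply: contra p_ndvd; apply: dvdn_mull.
apply: contrapT => /eqP; rewrite -dom_eq0.
case domE : (dom D) => [//|Q0 s] _.
have DQ0 : coeff Q0 D != 0 by rewrite -mem_dom domE mem_head.
have Q0i : Q0 <> infty by move=> Qi; rewrite Qi Dinf eqxx in DQ0.
have [h [hQ hord]] :=
  effective_over_K_principal D0 DK (ex_intro2 _ _ Q0 Q0i DQ0).
have DQ0_gt0 : 0 < coeff Q0 D by rewrite lt_neqAle eq_sym DQ0 D0.
have ordW Q : Q <> infty -> cY Q = 0 -> 0 < coeff Q D ->
    [/\ coeff Q D = 1, rhs^`().[cX Q] != 0 &
      exists v w G, evp G (cX Q) (cY Q) != 0 /\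
        forall x y, y ^+ 2 = rhs.[x] ->
          evp h x y * evp v x y * evp w x y = y * evp G x y].
  move=> Qi y0 DQ.
  have D1 : coeff Q D = 1 by have := coeff_hinv two Qi Dr DQ; rewrite y0 eqxx.
  split=> //.
    apply: rhs_separable => //; apply/rootP.
    by rewrite -affine_on_curve // y0 expr0n.
  have [v [w [G [GQ vwE]]]] := hord Q 1%N Qi D1; exists v, w, G; split=> //.
  by move=> x y xy; rewrite vwE // expr1 /unifp y0 eqxx evp_yp.
have norm0 : norm rhs h != 0.
  apply/eqP => /(norm_eq0 (rhs_neq0 g iota) (rhs_odd g iota)) h0.
  have [k kE] : exists k : nat, coeff Q0 D = k%:Z.
    by have := D0 Q0; case: (coeff Q0 D) => // k _; exists k.
  have [v [w [G [GQ vwE]]]] := hord Q0 k Q0i kE.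
  apply: (unit_at_neq0 (k := k) Q0i GQ) => x y xy; rewrite -vwE // h0.
  by rewrite [evp (0, 0) _ _]/evp /= !hornerE.
(* The degree of the norm is bounded root by root. Above a root lies a zero Q of h, hence a point of
   D. If y(Q) is not 0, then h does not vanish at Q^-, as D is reduced; if y(Q) = 0, the root is
   simple. *)
have mult_le x : root (norm rhs h) x ->
    exists Q : pt, [/\ Q <> infty, cX Q = x &
    exists2 k : nat, coeff Q D = k%:Z & ~~ (('X - x%:P) ^+ k.+1 %| norm rhs h)].
  move=> /rootP nx.
  have [y xy hxy] : exists2 y, y ^+ 2 = rhs.[x] & evp h x y = 0.
    have [y xy] := closed_sqrt rhs.[x].
    have /eqP := evp_norm h xy; rewrite nx eq_sym mulf_eq0 => /orP[]/eqP ?.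
      by exists y.
    by exists (- y); rewrite ?sqrrN.
  have [Q [Qi Qx Qy]] := point_of xy; exists Q; split=> //.
  have DQ : 0 < coeff Q D by rewrite -hQ // Qx Qy hxy.
  have [y0|y0] := eqVneq y 0.
    have [D1 f'x [v [w [G [GQ vwE]]]]] := ordW Q Qi (etrans Qy y0) DQ.
    exists 1%N => //; rewrite Qx in f'x; rewrite Qx Qy in GQ.
    exact: (weierstrass_norm_order (rhs_neq0 g iota) (rhs_odd g iota) xy GQ
      y0 f'x vwE hxy).
  have := coeff_hinv two Qi Dr DQ; rewrite Qy (negPf y0) => Dh.
  have [k kE] : exists k : nat, coeff Q D = k%:Z.
    by have := D0 Q; case: (coeff Q D) => // k _; exists k.
  have [v [w [G [GQ vwE]]]] := hord Q k Qi kE; exists k => //.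
  rewrite Qx Qy in GQ.
  apply: (norm_order (rhs_neq0 g iota) (rhs_odd g iota) xy GQ
    (v := v) (w := w)).
    by move=> x' y' xy'; rewrite vwE // /unifp Qy (negPf y0) evp_linp Qx.
  have [hi hX hY] := hinvE Qi.
  by rewrite -Qx -Qy -hX -hY hQ // Dh ltxx.
have h2 : h.2 = 0.
  apply: contrapT => /eqP h20.
  have := size_norm_ge (rhs_neq0 g iota) (rhs_odd g iota) h20.
  have [rs nE] := closed_field_poly_normal (norm rhs h).
  have lc0 : lead_coef (norm rhs h) != 0 by rewrite lead_coef_eq0.
  rewrite nE size_scale // size_prod_XsubC size_rhs.
  (* Points chosen above distinct roots are distinct, so the number of roots with multiplicity is at
     most deg D <= g, whereas it is at least 2g + 1. Outside [rs] the value [infty] is a mere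
     default. *)
  have /choice[Qf QfE] x : exists Q : pt, x \in rs -> [/\ Q <> infty, cX Q = x &
      (count_mem x rs)%:Z <= coeff Q D].
    have [xrs|] := boolP (x \in rs); last by exists infty.
    have [|Q [Qi Qx [k DQ ndvd]]] := mult_le x.
      by rewrite nE rootZ // root_prod_XsubC.
    exists Q => _; split=> //; rewrite DQ lez_nat leqNgt.
    apply: contra ndvd => lt_k; rewrite nE dvdpZr //.
    exact: dvdp_trans (dvdp_exp2l _ lt_k) (dvd_count_roots _ _).
  suff : (size rs)%:Z <= g%:Z by lia.
  apply: le_trans Dg; rewrite size_sum_count (big_morph Posz PoszD (erefl 0)).
  apply: le_trans (sum_coeff_le_deg D0 (s := [seq Qf x | x <- undup rs]) _).
    rewrite big_map [leLHS]big_seq [leRHS]big_seq; apply: ler_sum => x.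
    by rewrite mem_undup => /QfE[].
  rewrite map_inj_in_uniq ?undup_uniq // => x x'; rewrite !mem_undup.
  by move=> /QfE[_ xE _] /QfE[_ x'E _] QQ; rewrite -xE QQ x'E.
have hQ0 : evp h (cX Q0) (cY Q0) == 0 by rewrite hQ.
have h1 : h.1.[cX Q0] = 0.
  by move: hQ0; rewrite /evp h2 horner0 mul0r addr0 => /eqP.
(* Now h is a polynomial in x alone. At a Weierstrass point its zero would have order at least 2;
   elsewhere h would also vanish at the conjugate of [Q0], which is not in D. *)
have [y0|y0] := eqVneq (cY Q0) 0.
  have [_ f'x [v [w [G [GQ vwE]]]]] := ordW Q0 Q0i y0 DQ0_gt0.
  apply: (weierstrass_not_dvd (rhs_neq0 g iota) (rhs_odd g iota)
    (affine_on_curve Q0i) GQ y0 f'x vwE).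
  by rewrite h2 root0; split=> //; apply/rootP.
have := coeff_hinv two Q0i Dr DQ0_gt0; rewrite (negPf y0) => Dh.
have [hi hX hY] := hinvE Q0i.
have := hQ _ hi; rewrite Dh ltxx hX /evp h1 h2 horner0 mul0r addr0.
by rewrite eqxx.
Qed.

End TrivialJacobian.

(** * Vanishing of the three heights *)

Lemma h_dagger_nil (R : realType) (p : nat) (L : fieldExtType (ratfun p))
  (M : (L -> R) -> nat) : is_ML M -> h_dagger M [::] = 0.
Proof.
case=> absM _ _; rewrite /h_dagger big_nil /height_poly fsbig1 ?mulr0 // => w _.
have [->|/eqP Mw] := eqVneq (M w) 0%N; first by rewrite mul0r.
have [[w0 w00 wM _] _] := absM w Mw.
have w1 : w 1 = 1.
  have w1_neq0 : w 1 != 0 by apply/eqP => /w00/eqP; rewrite oner_eq0.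
  by apply: (mulfI w1_neq0); rewrite -wM !mulr1.
rewrite -(big_mkord xpredT (fun i => w (1 : {poly L})`_i)) size_poly1.
by rewrite big_ltn // big_geq // coef1 eqxx w1 max_l ?ler01 // ln1 mulr0.
Qed.

Lemma heart_bound_of_nonneg (R : realType) (g p : nat) (O : closedFieldType)
    (iota : {rmorphism ratfun p -> O}) (hhat : {freeg (pt g iota)} -> R)
    (B : R) :
  prime p -> ~~ (p %| 2 * (2 * g + 1))%N -> is_neron_tate hhat -> 0 <= B ->
  heart_bound hhat B.
Proof.
move=> p_prime p_ndvd [hlin hpar _] B0 q D ps qJ DK Dr Dinf qD psD.
move=> L j M zs _ ML.
have D_eq0 := reduced_over_K_eq0 p_prime p_ndvd DK Dr Dinf.
have -> : ps = [::].
  case: ps psD => // Q ps /(_ Q); rewrite /= eqxx D_eq0 coeff0.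
  by case: ifP => _ /eqP.
rewrite /coords_in; case: zs => //= _; rewrite h_dagger_nil //.
rewrite /h_heart big_nil; split=> //.
have J0 : jac_div (0 : {freeg (pt g iota)}).
  split; first exact: deg0.
  by exists D, D; rewrite subrr.
(* The parallelogram law at (0, 0) reads 2 [hhat 0] = 4 [hhat 0]. *)
have h0 : hhat 0 = 0.
  have := hpar 0 0 J0 J0; rewrite addr0 subr0 => /eqP.
  by rewrite -subr_eq0 => /eqP; lra.
rewrite (hlin q 0 qJ J0) ?h0 ?add0r //.
by move: qD; rewrite D_eq0 deg0 mulr0z subr0.
Qed.

Theorem theorem45 (R : realType) (g p : nat) (O : closedFieldType)
    (iota : {rmorphism ratfun p -> O}) (hhat : {freeg (pt g iota)} -> R)
    (g_gt0 : (0 < g)%N) (p_prime : prime p)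
    (p_ndvd : ~~ (p %| 2 * (2 * g + 1))%N)
    (O_algebraic : integralRange iota)
    (hhat_NT : is_neron_tate hhat) :
  [/\ p = 3%N -> g = 2%N -> heart_bound hhat (86 * ln 3),
      p = 5%N -> g = 4%N -> heart_bound hhat (417 * ln 5) &
      p = 101%N -> g = 11%N -> heart_bound hhat (5790 * ln 101)].
Proof.
(* It remains to see that the three constants are nonnegative. *)
by split=> _ _; apply: heart_bound_of_nonneg => //;
  rewrite mulr_ge0 ?ler0n // ln_ge0 // ler1n.
Qed.
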